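(* For each integer $k \geq 3$ there exists an $\varepsilon > 0$ such that for all integers $n$ and $c$, and for each orientation $C$ of a $k$-cycle consisting of exactly two blocks, one of which has length one, there exists a digraph $D$ with $|V(D)| \geq n$, $\chi(D) \geq c$, and minimum out-degree at least $\varepsilon |V(D)|$, such that $D$ does not contain a subdigraph isomorphic to $C$.
   Context: Digraphs have no loops and no parallel arcs (anti-parallel arcs allowed); $\chi(D)$ is the chromatic number of the underlying undirected graph; subdigraphs need not be induced. A block of an orientation of a cycle is a maximal connected subdigraph containing neither $x\rightarrow y\leftarrow z$ nor $x\leftarrow y\rightarrow z$ as a subdigraph; its length is its number of arcs. *)

(* Defs.v *)
From HB Require Import structures.
From mathcomp Require Import all_boot all_order all_algebra.
From mathcomp Require Import reals.
Set Implicit Arguments.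
Unset Strict Implicit.
Unset Printing Implicit Defensive.

(* Finite digraphs: no loops, no parallel arcs; anti-parallel arcs allowed. *)
Record digraph := Digraph {
  vertex :> finType;
  arc : rel vertex;
  arc_irr : irreflexive arc
}.

Arguments arc {d} x y.

Definition adj (D : digraph) : rel D := fun x y => arc x y || arc y x.

Definition outdeg (D : digraph) (x : D) : nat := #|[set y | arc x y]|.

(* Out-degrees never exceed #|D|, so the default value of the minimum matters
   only for the digraph without vertices, where it gives 0. *)
Definition min_outdeg (D : digraph) : nat :=
  \big[minn/#|D|]_(x : D) outdeg x.

Definition colorable (D : digraph) (m : nat) : bool :=
  [exists f : {ffun D -> 'I_m},
    [forall x, forall y, adj x y ==> (f x != f y)]].

Lemma colorable_ex (D : digraph) : exists m, colorable D m.
Proof.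
exists #|D|; apply/existsP; exists [ffun x => enum_rank x].
apply/forallP => x; apply/forallP => y; apply/implyP => xy; rewrite !ffunE.
apply: contraTneq xy => /enum_rank_inj ->.
by rewrite /adj !arc_irr.
Qed.

Definition chi (D : digraph) : nat := ex_minn (colorable_ex D).

(* A subdigraph, not necessarily induced, is a vertex set together with a set
   of arcs of D whose ends lie in the vertex set. *)
Definition subdigraph_axiom (D : digraph) (S : {set D} * {set D * D}) : bool :=
  [forall x, forall y, ((x, y) \in S.2) ==>
    [&& arc x y, x \in S.1 & y \in S.1]].

Definition subdigraph (D : digraph) : finType :=
  {S : {set D} * {set D * D} | subdigraph_axiom S}.

Definition sub_vertices (D : digraph) (S : subdigraph D) : {set D} :=
  (val S).1.

Definition sub_arcs (D : digraph) (S : subdigraph D) : {set D * D} :=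
  (val S).2.

Definition sub_rel (D : digraph) (S : subdigraph D) :
    rel {x : D | x \in sub_vertices S} :=
  fun x y => (val x, val y) \in sub_arcs S.

Lemma sub_rel_irr (D : digraph) (S : subdigraph D) : irreflexive (@sub_rel D S).
Proof.
move=> x; apply/negP => xx.
have /forallP/(_ (val x))/forallP/(_ (val x)) := valP S.
by rewrite -/(sub_arcs S) -/(sub_rel x x) xx arc_irr.
Qed.

Definition digraph_of_sub (D : digraph) (S : subdigraph D) : digraph :=
  Digraph (@sub_rel_irr D S).

Definition subdigraph_le (D : digraph) (S T : subdigraph D) : bool :=
  (sub_vertices S \subset sub_vertices T) && (sub_arcs S \subset sub_arcs T).

Definition isomorphic (D E : digraph) : Prop :=
  exists2 f : D -> E, bijective f & forall x y, arc (f x) (f y) = arc x y.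

Definition contains (D E : digraph) : Prop :=
  exists S : subdigraph D, isomorphic (digraph_of_sub S) E.

(* Connectedness of the underlying undirected graph. *)
Definition connected (D : digraph) : bool :=
  (0 < #|D|) && [forall x : D, forall y : D, connect (@adj D) x y].

(* x -> y <- z and x <- y -> z; the vertex y differs from x and z since there
   are no loops. *)
Definition has_in_cherry (D : digraph) : bool :=
  [exists x : D, exists y : D, exists z : D, [&& x != z, arc x y & arc z y]].

Definition has_out_cherry (D : digraph) : bool :=
  [exists x : D, exists y : D, exists z : D, [&& x != z, arc y x & arc y z]].

Definition preblock (D : digraph) (S : subdigraph D) : bool :=
  let E := digraph_of_sub S in
  [&& connected E, ~~ has_in_cherry E & ~~ has_out_cherry E].

Definition blocks (D : digraph) : {set subdigraph D} :=
  [set S | preblock S &&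
    [forall T : subdigraph D, preblock T && subdigraph_le S T ==> (T == S)]].

Definition block_length (D : digraph) (S : subdigraph D) : nat :=
  #|sub_arcs S|.

Definition cycle_adj (k : nat) : rel 'I_k :=
  fun i j => (j == ordS i) || (i == ordS j).

(* For k >= 3: the underlying graph is a k-cycle, and each edge carries
   exactly one arc. *)
Definition cycle_orientation (k : nat) (C : digraph) : Prop :=
  (forall x y : C, ~~ (arc x y && arc y x)) /\
  exists2 f : 'I_k -> C, bijective f &
    forall i j, adj (f i) (f j) = cycle_adj i j.

(* Main.v *)
(** The cycle [C] is a directed path [v_1 -> ... -> v_k] together with the arc
    [v_1 -> v_k].  Let [H] be the shift graph on increasing [(k-1)]-tuples from
    [{0,...,N}], with [(a_1,...,a_{k-1}) -> (a_2,...,a_k)]; its chromatic number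
    tends to infinity with [N].  Let [V] be a large blow-up of the directed
    [(k-1)]-cycle in which every level is indexed by the subsets [A] of
    [{0,...,N}] (times a multiplicity), and join [(a_1,...,a_{k-1})] to the
    vertices [A] of level 0 with [a_1 \in A] and [a_{k-1} \notin A], a quarter
    of that level.  No arc leaves [V] for [H], so a copy of [C] would be of one
    of three kinds.  Inside [V], levels modulo [k-1] forbid it.  Inside [H],
    first coordinates increase strictly along arcs, while [v_2] and [v_k] have
    the same first coordinate since both are out-neighbours of [v_1].
    Otherwise [v_1 \in H] and [v_k \in V] has level 0, so levels force [v_k] to
    be the only vertex in [V]; then the first coordinate of [v_{k-1}] is the
    last coordinate of [v_1], and no [A] is an out-neighbour of both. *)
Require Import Defs.
From mathcomp Require Import all_boot all_order all_algebra.
From mathcomp Require Import reals.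
From mathcomp Require Import zify.
(* [path.arc] would otherwise shadow [Defs.arc]. *)
Import Defs.
Import Order.TTheory GRing.Theory Num.Theory.
Local Open Scope ring_scope.

Set Implicit Arguments.
Unset Strict Implicit.
Unset Printing Implicit Defensive.

(** * Blocks of a digraph, and what a block with a single arc forces *)

Section Blocks.
Local Open Scope nat_scope.
Variable C : digraph.
Implicit Types (S T : subdigraph C) (x y z : C).

Lemma sub_arcsP S x y : (x, y) \in sub_arcs S ->
  [/\ arc x y, x \in sub_vertices S & y \in sub_vertices S].
Proof.
move=> xyS; have /forallP/(_ x)/forallP/(_ y) := valP S.
by rewrite -/(sub_arcs S) xyS => /and3P[].
Qed.

Lemma subdigraph_ext S T : sub_vertices S = sub_vertices T ->
  sub_arcs S = sub_arcs T -> S = T.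
Proof.
move=> eV eA; apply: val_inj.
by rewrite [LHS]surjective_pairing [RHS]surjective_pairing; congr pair.
Qed.

(** Among the preblocks above [S], one with the most vertices and arcs in total is maximal for
    inclusion. *)
Lemma preblock_sub_block S : preblock S ->
  exists2 T, T \in blocks C & subdigraph_le S T.
Proof.
move=> pS.
pose mu T := #|sub_vertices T| + #|sub_arcs T|.
have S0 : preblock S && subdigraph_le S S by rewrite pS /subdigraph_le !subxx.
case: (@arg_maxnP _ S (fun T => preblock T && subdigraph_le S T) mu S0).
move=> T /andP[pT leST] maxT; exists T => //.
rewrite inE pT; apply/forallP => T'; apply/implyP => /andP[pT' /andP[sV sA]].
have leST' : subdigraph_le S T'.
  by case/andP: leST => s1 s2; rewrite /subdigraph_le
    (subset_trans s1 sV) (subset_trans s2 sA).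
have := maxT T'; rewrite pT' leST' /mu /geq /= => /(_ isT) le_mu.
have cV := subset_leq_card sV; have cA := subset_leq_card sA.
apply/eqP/esym/subdigraph_ext; apply/eqP; rewrite eqEcard ?sV ?sA /=.
  rewrite -(leq_add2r #|sub_arcs T'|); apply: leq_trans le_mu _.
  by rewrite leq_add2l.
rewrite -(leq_add2l #|sub_vertices T'|); apply: leq_trans le_mu _.
by rewrite leq_add2r.
Qed.

Lemma star_connected S y : y \in sub_vertices S ->
  (forall x, x \in sub_vertices S ->
     [|| x == y, (x, y) \in sub_arcs S | (y, x) \in sub_arcs S]) ->
  connected (digraph_of_sub S).
Proof.
move=> yS star; pose E := digraph_of_sub S; pose y' : E := Sub y yS.
have symE : connect_sym (@adj E).
  by apply: sym_connect_sym => u v; rewrite /adj orbC.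
have to_y (u : E) : connect (@adj E) u y'.
  have := star (val u) (valP u) => /orP[/eqP uy|uy].
    by rewrite (_ : u = y') //; apply: val_inj.
  exact: connect1.
apply/andP; split; first by apply/card_gt0P; exists y'.
apply/forallP => u; apply/forallP => v.
by apply: connect_trans (to_y u) _; rewrite symE.
Qed.

(** A single arc with its two ends is a preblock, so it extends to a block. *)
Lemma arc_in_block x y : arc x y ->
  exists2 T, T \in blocks C & (x, y) \in sub_arcs T.
Proof.
move=> xy.
have ax : subdigraph_axiom ([set x; y], [set (x, y)]).
  apply/forallP => u; apply/forallP => v; apply/implyP.
  by rewrite inE => /eqP[-> ->]; rewrite xy !inE !eqxx orbT.
pose S : subdigraph C := Sub _ ax.
have pS : preblock S.
  apply/and3P; split.
  - apply: (@star_connected S y); first by rewrite !inE eqxx orbT.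
    by move=> u; rewrite !inE => /orP[] /eqP ->; rewrite !eqxx ?orbT.
  - apply/existsP => -[u /existsP[v /existsP[w /and3P[uw]]]].
    rewrite /= /sub_rel !inE => /eqP[eu _] /eqP[ew _].
    by case/eqP: uw; exact/val_inj/(etrans eu (esym ew)).
  - apply/existsP => -[u /existsP[v /existsP[w /and3P[uw]]]].
    rewrite /= /sub_rel !inE => /eqP[_ eu] /eqP[_ ew].
    by case/eqP: uw; exact/val_inj/(etrans eu (esym ew)).
have [T bT /andP[_ sA]] := preblock_sub_block pS; exists T => //.
by apply: (subsetP sA); rewrite inE.
Qed.

Lemma block_no_out_cherry T x y z : T \in blocks C ->
  (y, x) \in sub_arcs T -> (y, z) \in sub_arcs T -> x = z.
Proof.
rewrite inE => /andP[/and3P[_ _ nc] _] yx yz; apply/eqP; apply: contraNT nc.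
have [_ yT xT] := sub_arcsP yx; have [_ _ zT] := sub_arcsP yz.
move=> xz; pose E := digraph_of_sub T.
apply/existsP; exists (Sub x xT : E); apply/existsP; exists (Sub y yT : E).
apply/existsP; exists (Sub z zT : E).
by rewrite /= /sub_rel /= yx yz !andbT.
Qed.

Hypothesis asymC : forall x y, ~~ (arc x y && arc y x).

Lemma arc_neq x y : arc x y -> x != y.
Proof. by apply: contraTneq => ->; rewrite arc_irr. Qed.

Lemma path2_preblock S x y z : arc x y -> arc y z ->
  sub_vertices S = [set x; y; z] -> sub_arcs S = [set (x, y); (y, z)] ->
  preblock S.
Proof.
move=> xy yz eV eA.
have nxy := arc_neq xy; have nyz := arc_neq yz.
have nxz : x != z.
  by apply/eqP => exz; have := asymC x y; rewrite xy exz yz.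
apply/and3P; split.
- apply: (@star_connected S y); first by rewrite eV !inE eqxx orbT.
  move=> u; rewrite eV eA !inE => /orP[/orP[]|] /eqP ->;
  by rewrite !eqxx ?orbT.
- apply/existsP => -[u /existsP[v /existsP[w /and3P[uw]]]].
  rewrite /= /sub_rel !eA !inE => /orP[] /eqP[eu ev] /orP[] /eqP[ew];
    rewrite ev => e;
    try (by case/eqP: uw; exact/val_inj/(etrans eu (esym ew)));
    by move: nyz; rewrite e eqxx.
- apply/existsP => -[u /existsP[v /existsP[w /and3P[uw]]]].
  rewrite /= /sub_rel !eA !inE => /orP[] /eqP[ev eu] /orP[] /eqP[];
    rewrite ev => e ew;
    try (by case/eqP: uw; exact/val_inj/(etrans eu (esym ew)));
    by move: nxy; rewrite e eqxx.
Qed.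

(** An arc leaving [y] would extend the block to the path x -> y -> z, a strictly larger
    preblock. *)
Lemma block_length1_sink S x y z : S \in blocks C ->
  sub_arcs S = [set (x, y)] -> ~~ arc y z.
Proof.
move=> bS eA; apply/negP => yz.
have xyS : (x, y) \in sub_arcs S by rewrite eA inE.
have [xy xS yS] := sub_arcsP xyS.
have ax : subdigraph_axiom ([set x; y; z], [set (x, y); (y, z)]).
  apply/forallP => u; apply/forallP => v; apply/implyP.
  by rewrite !inE => /orP[] /eqP[-> ->]; rewrite ?xy ?yz !eqxx ?orbT.
pose T : subdigraph C := Sub _ ax.
have pT : preblock T by apply: (path2_preblock xy yz).
move: bS; rewrite inE => /andP[/and3P[/andP[_ /forallP conS] _ _]].
(* By connectedness, any vertex other than [x] has a first step towards [x], which must use the only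
   arc. *)
have sV : sub_vertices S \subset [set x; y].
  apply/subsetP => u uS; rewrite !inE.
  pose E := digraph_of_sub S.
  pose u' : E := Sub u uS; pose x' : E := Sub x xS.
  have /forallP/(_ x') := conS u'.
  case/connectP => -[|v p] /=.
    by move=> _ /(congr1 val) /= ->; rewrite eqxx.
  case/andP; rewrite /adj /= /sub_rel /= eA !inE.
  by case/orP => /eqP[]; [move=> -> | move=> _ ->]; rewrite eqxx ?orbT.
move=> /forallP/(_ T)/implyP; rewrite pT andTb => eT.
have : (y, z) \in sub_arcs S.
  rewrite -(eqP (eT _)); first by rewrite !inE eqxx orbT.
  apply/andP; split; last by rewrite eA sub1set set21.
  by apply: subset_trans sV _; apply/subsetP => u; rewrite !inE => ->.
rewrite eA inE => /eqP[eyx _]; by move: xy; rewrite eyx arc_irr.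
Qed.

End Blocks.

(** * Orientations of a cycle: from two blocks to a directed path with a shortcut *)

Section Cycle.
Local Open Scope nat_scope.

Lemma val_iter_ordS n (i : 'I_n) j : iter j (@ordS n) i = (i + j) %% n :> nat.
Proof.
elim: j => [|j IH]; first by rewrite addn0 modn_small.
by rewrite iterS /= IH -addn1 modnDml addn1 addnS.
Qed.

Lemma iter_ordS_inj n (i : 'I_n) j l : j < n -> l < n ->
  iter j (@ordS n) i = iter l (@ordS n) i -> j = l.
Proof.
move=> jn ln /(congr1 val) /=; rewrite !val_iter_ordS => /eqP.
by rewrite eqn_modDl !modn_small // => /eqP.
Qed.

Lemma iter_ordS_pred n (i : 'I_n) : iter n.-1 (@ordS n) (ordS i) = i.
Proof.
apply: val_inj => /=; rewrite -iterSr val_iter_ordS.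
by rewrite prednK ?modnDr ?modn_small // (leq_ltn_trans _ (ltn_ord i)).
Qed.

(** This is the long way round from [b] to [a]: iterating [ordS] from one end of an edge reaches the
    other end in one step or in k - 1. *)
Lemma cycle_trail k (C : digraph) (a b : C) :
  cycle_orientation k C -> adj a b ->
  exists g : nat -> C, [/\ g 0 = b, g k.-1 = a,
    forall j, j.+1 < k -> adj (g j) (g j.+1) &
    forall i j, i < k -> j < k -> g i = g j -> i = j].
Proof.
case=> _ [f bij_f adjf].
have [f' fK f'K] := bij_f; have inj_f := bij_inj bij_f.
rewrite -{1}(f'K a) -{1}(f'K b) adjf /cycle_adj.
set i := f' a; set l := f' b.
case/orP => /eqP e.
  exists (fun j => f (iter j (@ordS k) l)); split=> //=.
  - by rewrite f'K.
  - by rewrite e iter_ordS_pred f'K.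
  - by move=> j jk; rewrite adjf /cycle_adj eqxx.
  - by move=> p q pk qk /inj_f /iter_ordS_inj; apply.
(* Here [a] is the successor of [b], so iterating [ordS] leads from [a] to [b], and the walk is read
   backwards. *)
exists (fun j => f (iter (k.-1 - j) (@ordS k) i)); split=> //=.
- by rewrite subn0 e iter_ordS_pred f'K.
- by rewrite subnn f'K.
- move=> j jk; rewrite adjf /cycle_adj.
  by rewrite (_ : k.-1 - j = (k.-1 - j.+1).+1) ?iterS ?eqxx ?orbT //; lia.
- move=> p q pk qk /inj_f /iter_ordS_inj; lia.
Qed.

(* All arcs but the one of the block of length one lie in the other block, which
   contains no out-cherry; walking around the cycle from the sink [b] towards
   [a], this orients every arc towards [b]. *)
Lemma two_block_walk k (C : digraph) : 1 < k ->
  cycle_orientation k C -> #|blocks C| = 2 ->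
  (exists2 B : subdigraph C, B \in blocks C & block_length B = 1) ->
  exists w : nat -> C,
    (forall j, j.+1 < k -> arc (w j) (w j.+1)) /\ arc (w 0) (w k.-1).
Proof.
move=> k1 cC; have [asym _] := cC; move=> card2 [B bB /eqP/cards1P[[a b] eA]].
have [ab _ _] : [/\ arc a b, a \in sub_vertices B & b \in sub_vertices B].
  by apply: sub_arcsP; rewrite eA inE.
have [B' eB'] : exists B', blocks C :\ B = [set B'].
  by apply/cards1P; move: card2; rewrite (cardsD1 B) bB add1n => -[->].
have inB' x y : arc x y -> (x, y) != (a, b) -> (x, y) \in sub_arcs B'.
  move=> xy nab; have [T bT xyT] := arc_in_block xy.
  have : T \in blocks C :\ B.
    by rewrite !inE in bT *; rewrite bT andbT; apply: contraNneq nab => eT;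
       rewrite -in_set1 -eA -eT.
  by rewrite eB' inE => /eqP <-.
have bB' : B' \in blocks C.
  have : B' \in blocks C :\ B by rewrite eB' set11.
  by rewrite in_setD1 => /andP[].
have adjab : adj a b by rewrite /adj ab.
have [g [g0 ga adjg injg]] := cycle_trail cC adjab.
have back j : j.+1 < k -> arc (g j.+1) (g j).
  elim: j => [|j IH] jk; have := adjg _ jk; rewrite /adj => /orP[fwd|//].
    by move: fwd; rewrite g0 (negPf (block_length1_sink asym _ bB eA)).
  have arcB' l : l < k -> arc (g j.+1) (g l) -> (g j.+1, g l) \in sub_arcs B'.
    move=> lk /inB'; apply; apply/eqP => -[ea _].
    suff : j.+1 = k.-1 by lia.
    by apply: injg; rewrite ?ga //; lia.
  have jk' : j < k by lia.
  have := block_no_out_cherry bB' (arcB' _ jk' (IH (ltnW jk))) (arcB' _ jk fwd).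
  by move/injg; lia.
exists (fun j => g (k.-1 - j)); rewrite subn0 subnn g0 ga; split=> // j jk.
by rewrite (_ : k.-1 - j = (k.-1 - j.+1).+1); [apply: back|]; lia.
Qed.

End Cycle.

(** * Chromatic number of shift graphs, and counting separating sets *)

Section Shift.
Local Open Scope nat_scope.

(* A colouring [f] of the [m+2]-tuples induces a colouring [g] of the
   [m+1]-tuples by sets of colours, and a collision of [g] yields one of [f]. *)
Lemma shift_chromatic m (T : finType) : exists N, forall f : seq nat -> T,
  exists s, [/\ size s = m.+2, sorted ltn s, all (fun x => x < N) s &
    f (take m.+1 s) = f (behead s)].
Proof.
elim: m T => [|m IH] T.
  exists #|T|.+1 => f.
  have /injectivePn[i [j nij eij]] :
      ~~ injectiveb (fun i : 'I_#|T|.+1 => f [:: val i]).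
    apply/negP => /injectiveP/leq_card; rewrite card_ord; lia.
  wlog ltij : i j nij eij / i < j.
    move=> wl; have [|/wl|e] := ltngtP i j; first exact: wl.
      by apply; rewrite // eq_sym.
    by case/eqP: nij; apply: val_inj.
  by exists [:: val i; val j]; split; rewrite //= ?ltij ?ltn_ord.
have [N HN] := IH {set T}; exists N => f.
pose g s := [set c | [exists b : 'I_N,
  sorted ltn (rcons s (val b)) && (f (rcons s (val b)) == c)]].
have [s [sz srt sN eg]] := HN g.
case: s sz srt sN eg => [//|x s1] [sz] srt /= /andP[xN s1N] eg.
(* The colour of [x :: s1] is that of an extension of its initial segment. As [g] collides, some
   extension of [s1] by a last entry [b] has it too, and appending [b] to [x :: s1] gives the
   collision of [f]. *)
have : f (x :: s1) \in g (x :: take m s1).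
  rewrite inE; apply/existsP.
  case/lastP: s1 sz srt s1N eg => // s y; rewrite size_rcons => -[sz] srt.
  rewrite all_rcons => /andP[yN _] _; exists (Ordinal yN) => /=.
  have -> : take m (rcons s y) = s by rewrite -cats1 take_size_cat.
  by rewrite eqxx andbT.
rewrite [g _]eg inE => /existsP[b /andP[srtb /eqP eb]].
exists (x :: rcons s1 (val b)); split.
- by rewrite /= size_rcons sz.
- by case: s1 sz srt srtb {s1N eg eb} => //= y s1 _ /andP[-> _] ->.
- by rewrite /= all_rcons xN s1N ltn_ord.
- by rewrite /= -cats1 take_size_cat // cats1 -eb.
Qed.

(** Adding [h] maps the subsets of the complement of {h, l}, a quarter of all subsets, injectively
    to separating sets. *)
Lemma card_separating_sets (I : finType) (h l : I) : h != l ->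
  2 ^ #|I| <= 4 * #|[set A : {set I} | (h \in A) && (l \notin A)]|.
Proof.
move=> hl; pose P := powerset (~: [set h; l]).
have -> : 2 ^ #|I| = 4 * #|P|.
  by rewrite card_powerset -(cardsC [set h; l]) cards2 hl expnD.
rewrite leq_mul2l /= -(card_in_imset (f := fun A => h |: A) (D := mem P)).
  apply/subset_leq_card/subsetP => _ /imsetP[A /= AP ->].
  move: AP; rewrite !inE eqxx /= => /subsetP AP.
  rewrite negb_or eq_sym hl /=; apply/negP => /AP.
  by rewrite !inE eqxx orbT.
move=> A B; rewrite !inE => /subsetP AP /subsetP BP eAB.
have nA (E : {set I}) : {subset E <= ~: [set h; l]} -> (h |: E) :\ h = E.
  move=> EP; rewrite setU1K //; apply/negP => /EP.
  by rewrite !inE eqxx.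
by rewrite -(nA A AP) -(nA B BP) eAB.
Qed.

End Shift.

(** * The shift graph joined to the blow-up: out-degrees and the forbidden walk *)

Section Construction.
Local Open Scope nat_scope.
Variables m N t : nat.
Hypothesis m_gt0 : 0 < m.

Definition increasing (u : m.+1.-tuple 'I_N.+1) := sorted ltn (map val u).

Definition shift_arc (u v : m.+1.-tuple 'I_N.+1) :=
  [&& increasing u, increasing v & behead u == take m v].

Lemma shift_arc_nth u v i : shift_arc u v -> i < m ->
  nth ord0 v i = nth ord0 u i.+1.
Proof.
by case/and3P=> _ _ /eqP e im; rewrite -(nth_take _ im) -e nth_behead.
Qed.

Lemma increasing_nth u i j : increasing u -> i < j -> j <= m ->
  nth ord0 u i < nth ord0 u j.
Proof.
move=> inc ij jm.
have nthE l : l <= m -> nth ord0 u l = nth 0 (map val u) l :> nat.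
  by move=> lm; rewrite (nth_map ord0) // size_tuple.
rewrite !nthE //; last by apply: leq_trans jm; apply: ltnW.
by apply: (sorted_ltn_nth ltn_trans) => //;
  rewrite inE size_map size_tuple; lia.
Qed.

Lemma shift_arc_head u v : shift_arc u v -> nth ord0 u 0 < nth ord0 v 0.
Proof.
move=> uv; rewrite (shift_arc_nth uv) //.
by case/and3P: uv => incu _ _; apply: increasing_nth.
Qed.

Definition level_set := ('I_m.+1 * {set 'I_N.+1} * 'I_t)%type.

Definition glued_vertex : finType := (m.+1.-tuple 'I_N.+1 + level_set)%type.

(* Tuples that are not increasing are isolated in [H]; they are joined to all of
   level 0 only to have large out-degree. *)
Definition glued_arc : rel glued_vertex := fun x y =>
  match x, y with
  | inl u, inl v => shift_arc u v
  | inl u, inr (i, A, _) => (i == ord0) &&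
      (increasing u ==> (nth ord0 u 0 \in A) && (nth ord0 u m \notin A))
  | inr _, inl _ => false
  | inr (i, _, _), inr (j, _, _) => j == ordS i
  end.

Lemma glued_arc_irr : irreflexive glued_arc.
Proof.
case=> [u|[[i A] s]] /=; first by apply/negP => /shift_arc_head; rewrite ltnn.
apply/negP => /eqP /(congr1 val) /=; have := ltn_ord i.
rewrite ltnS leq_eqVlt => /orP[/eqP ->|im]; first by rewrite modnn; lia.
by rewrite modn_small //; lia.
Qed.

Definition glued := Digraph glued_arc_irr.

Lemma card_glued : #|glued| = N.+1 ^ m.+1 + m.+1 * 2 ^ N.+1 * t.
Proof.
rewrite /glued /= card_sum card_tuple !card_prod !card_ord.
by rewrite -cardsT -powersetT card_powerset cardsT card_ord.
Qed.

(** Every vertex dominates, on one level, all [t] copies of each set of a family [F] that contains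
    at least a quarter of the index sets. *)
Lemma outdeg_glued (x : glued) : 2 ^ N.+1 * t <= 4 * outdeg x.
Proof.
have fibre (i : 'I_m.+1) (F : {set {set 'I_N.+1}}) :
    (forall A s, A \in F -> arc x (inr (i, A, s) : glued)) ->
    2 ^ N.+1 <= 4 * #|F| -> 2 ^ N.+1 * t <= 4 * outdeg x.
  move=> xF le; apply: (@leq_trans (4 * #|F| * t)).
    by rewrite leq_mul2r le orbT.
  rewrite -mulnA leq_mul2l /= -{1}(card_ord t) -cardsT -cardsX.
  pose h (p : {set 'I_N.+1} * 'I_t) : glued := inr (i, p.1, p.2).
  rewrite -(card_imset (f := h)); last by move=> [A s] [B r] [-> ->].
  apply/subset_leq_card/subsetP => _ /imsetP[[A s] /setXP[AF _] ->].
  by rewrite inE; apply: xF.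
have full : 2 ^ N.+1 <= 4 * #|[set: {set 'I_N.+1}]|.
  by rewrite -powersetT card_powerset cardsT card_ord; lia.
case: x fibre => [u|[[i A] s]] fibre.
  have [inc|ninc] := boolP (increasing u); last first.
    by apply: (fibre ord0 setT) => // A s _ /=; rewrite (negPf ninc).
  apply: (fibre ord0 [set A : {set 'I_N.+1} |
                        (nth ord0 u 0 \in A) && (nth ord0 u m \notin A)]).
    by move=> A s; rewrite inE /= => ->; rewrite implybT.
  rewrite -{1}(card_ord N.+1); apply: card_separating_sets.
  by apply: contraTneq (increasing_nth inc m_gt0 (leqnn m)) => ->; rewrite ltnn.
by apply: (fibre (ordS i) setT) => // B r _ /=.
Qed.

(** With k = m + 2, the vertex v_{j+1} of the cycle is [w j]; the cases are those of the
    overview. *)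
Lemma glued_no_walk (w : nat -> glued) :
  (forall j, j <= m -> arc (w j) (w j.+1)) -> ~~ arc (w 0) (w m.+1).
Proof.
move=> arcw; apply/negP => arc0.
(* [low] marks the shift graph; [tup] and [lev] have dummy values outside the part they describe. *)
pose low (x : glued) := if x is inl _ then true else false.
pose tup (x : glued) := if x is inl u then u else [tuple of nseq m.+1 ord0].
pose lev (x : glued) : nat := if x is inr (i, _, _) then i else 0.
have low_arc (x y : glued) : arc x y -> low y -> low x.
  by case: x y => [?|[[? ?] ?]] [].
have lev_low (x y : glued) : arc x y -> low x -> ~~ low y -> lev y = 0.
  by case: x y => [?|[[? ?] ?]] // [?|[[? ?] ?]] //= /andP[/eqP ->].
have lev_high (x y : glued) : arc x y -> ~~ low x -> lev y = (lev x).+1 %% m.+1.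
  by case: x y => [?|[[? ?] ?]] // [?|[[? ?] ?]] //= /eqP ->.
have low_le i j : i <= j -> j <= m.+1 -> low (w j) -> low (w i).
  elim: j => [|j IH]; first by rewrite leqn0 => /eqP ->.
  rewrite leq_eqVlt ltnS => /orP[/eqP -> //|ij] jm lowj.
  apply: IH => //; first lia.
  by apply: low_arc (arcw _ _) lowj; lia.
have lev_walk i j : ~~ low (w i) -> i + j <= m.+1 ->
    lev (w (i + j)) = (lev (w i) + j) %% m.+1.
  move=> highi; elim: j => [|j IH] ijm.
    rewrite !addn0 modn_small //.
    by case: (w i) => [|[[]]] //= l _ _; apply: ltn_ord.
  rewrite addnS (lev_high (w (i + j))) ?IH ?addnS; try lia.
  - by rewrite -addn1 modnDml addn1.
  - by apply: arcw; lia.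
  - by apply: contra highi; apply: low_le; lia.
have lev_lt x : lev x < m.+1 by case: x => [|[[]]] //= *; apply: ltn_ord.
have [low0|high0] := boolP (low (w 0)); last first.
  (* All of the walk is in the blow-up: m + 1 steps return to the level of [w 0], but the shortcut
     moves one level on, modulo m + 1 > 1. *)
  have := lev_walk 0 m.+1 high0 (leqnn _); rewrite add0n (lev_high _ _ arc0) //.
  rewrite modnDr (modn_small (lev_lt _)); have := lev_lt (w 0).
  rewrite ltnS leq_eqVlt => /orP[/eqP ->|im]; first by rewrite modnn; lia.
  by rewrite modn_small //; lia.
have tup_arc j : low (w j.+1) -> j <= m -> shift_arc (tup (w j)) (tup (w j.+1)).
  move=> lowj jm; have := low_arc _ _ (arcw j jm) lowj; have := arcw j jm.
  by move: lowj; case: (w j) (w j.+1) => [?|[[? ?] ?]] [?|[[? ?] ?]].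
have [lowm|highm] := boolP (low (w m.+1)).
  (* All of the walk is in the shift graph: [w 1] and [w m.+1] share their first entry, although
     first entries increase along the walk. *)
  have head_arc x y : arc x y -> low x -> low y ->
      nth ord0 (tup y) 0 = nth ord0 (tup x) 1.
    by case: x y => [?|[[? ?] ?]] [?|[[? ?] ?]] //= xy _ _; apply: shift_arc_nth.
  have e : nth ord0 (tup (w m.+1)) 0 = nth ord0 (tup (w 1)) 0.
    rewrite (head_arc _ _ arc0) // (head_arc (w 0)) ?arcw //.
    by apply: low_le lowm; lia.
  have lowj j : j <= m.+1 -> low (w j) by move=> jm; apply: low_le lowm.
  have mono j : j < m -> nth ord0 (tup (w 1)) 0 < nth ord0 (tup (w j.+2)) 0.
    elim: j => [|j IH] jm.
      by apply/shift_arc_head/tup_arc => //; apply: lowj; lia.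
    apply: ltn_trans (IH (ltnW jm)) _.
    by apply/shift_arc_head/tup_arc => //; apply: lowj; lia.
  have := mono m.-1; rewrite prednK // e ltnn; lia.
(* Otherwise the walk enters the blow-up at some [w j.+1] with j < m, on level 0, and reaches
   [w m.+1] on level m - j > 0, whereas the shortcut puts it on level 0. *)
have lowm' : low (w m).
  have [//|highi] := boolP (low (w m)).
  have [j jm /andP[lowj highj]] :
      exists2 j, j < m & low (w j) && ~~ low (w j.+1).
    elim: (m) highi => [|p IH] highp; first by rewrite low0 in highp.
    have [lowp|/IH[j jp lj]] := boolP (low (w p)); last first.
      by exists j; rewrite // ltnW.
    by exists p; rewrite // lowp.
  have := lev_walk j.+1 (m - j) highj; rewrite addSn subnKC ?(ltnW jm) // leqnn.
  rewrite (lev_low _ _ arc0) // (lev_low _ _ (arcw j (ltnW jm))) // add0n.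
  by rewrite modn_small => [/(_ isT)|]; lia.
have tupw i j : i + j <= m ->
    nth ord0 (tup (w i)) j = nth ord0 (tup (w 0)) (i + j).
  elim: i j => [//|i IH] j ijm.
  have lowi : low (w i.+1) by apply: low_le lowm'; lia.
  have im : i <= m by lia.
  rewrite (shift_arc_nth (tup_arc i lowi im)); last by lia.
  by rewrite IH addnS ?addSn //; lia.
(* The membership condition in [glued_arc] is guarded by [increasing]; both tuples satisfy it as
   ends of shift arcs, which exist since m > 0. *)
have inc0 : increasing (tup (w 0)).
  have /and3P[//] : shift_arc (tup (w 0)) (tup (w 1)).
  by apply: tup_arc => //; apply: low_le lowm'; lia.
have incm : increasing (tup (w m)).
  have /and3P[//] : shift_arc (tup (w m.-1)) (tup (w m.-1.+1)).
    by apply: tup_arc; rewrite ?prednK //; lia.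
  by rewrite prednK.
(* The last entry of [w 0], excluded from [A] by the shortcut, is the first entry of [w m], which
   must lie in [A]. *)
have := tupw m 0; rewrite addn0 leqnn => /(_ isT).
move: arc0 (arcw m (leqnn m)) low0 lowm' highm inc0 incm.
case: (w 0) => // u; case: (w m) => // v; case: (w m.+1) => // -[[i A] s] /=.
move=> /andP[_ uA] /andP[_ vA] _ _ _ incu incv evu.
by move: uA vA; rewrite incu incv evu => /= /andP[_ /negPf ->].
Qed.

End Construction.

(** * Lower bounds on the chromatic number and the minimum out-degree *)

Section Bounds.
Local Open Scope nat_scope.

Lemma leq_chi (D : digraph) q :
  (forall p, p <= q -> ~~ colorable D p) -> q < chi D.
Proof.
move=> nc; rewrite /chi; case: ex_minnP => p cp _; rewrite ltnNge.
by apply/negP => /nc; rewrite cp.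
Qed.

(** [N] is chosen before [t], so that the multiplicity can later depend on it. A proper colouring
    would restrict to one of the shift graph. *)
Lemma chi_glued m q : exists N, forall t (m_gt0 : 0 < m),
  q < chi (glued N t m_gt0).
Proof.
have [N HN] := shift_chromatic m 'I_q.+1; exists N => t m_gt0.
apply: leq_chi => p pq; apply/negP => /existsP[g /forallP gP].
pose toN (s : seq nat) : seq 'I_N.+1 := map inord s.
(* The colouring is extended to all sequences; the default 0 is taken only at lengths other than m +
   1. *)
pose f (s : seq nat) : 'I_q.+1 :=
  inord (if insub (toN s) is Some u then g (inl u) : nat else 0).
have [s [sz srt sN ef]] := HN f.
have toNK r : {subset r <= s} -> map val (toN r) = r.
  move=> rs; rewrite -map_comp map_id_in // => x /rs xs /=.
  by rewrite inordK // ltnW // ltnS; apply: (allP sN).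
have sub_take : {subset take m.+1 s <= s} by move=> x; apply: mem_take.
have sub_behead : {subset behead s <= s} by move=> x; apply: mem_behead.
have szu : size (toN (take m.+1 s)) == m.+1 by rewrite size_map size_takel ?sz.
have szv : size (toN (behead s)) == m.+1 by rewrite size_map size_behead sz.
pose u : m.+1.-tuple 'I_N.+1 := Tuple szu.
pose v : m.+1.-tuple 'I_N.+1 := Tuple szv.
have uv : shift_arc u v.
  apply/and3P; split.
  - by rewrite /increasing /= toNK // take_sorted.
  - rewrite /increasing /= toNK //.
    by case: (s) srt => //= x s'; apply: path_sorted.
  - rewrite /= /toN behead_map -map_take.
    by case: (s) sz.
have /forallP/(_ (inl v)) := gP (inl u); rewrite {1}/adj /= uv /=.
move: ef; have insu : insub (toN (take m.+1 s)) = Some u by apply: insubT.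
have insv : insub (toN (behead s)) = Some v by apply: insubT.
rewrite /f insu insv => /(congr1 val).
have small x : g x < q.+1 by rewrite ltnS ltnW // (leq_trans (ltn_ord _)).
by rewrite /= !inordK // => /val_inj ->; rewrite eqxx.
Qed.

Lemma min_outdeg_ge (D : digraph) a :
  0 < a -> (forall x : D, #|D| <= a * outdeg x) -> #|D| <= a * min_outdeg D.
Proof.
move=> a_gt0 aP; rewrite /min_outdeg.
(* The default value [#|D|] of the minimum meets the bound because [a] is positive. *)
elim/big_ind: _ => [|x y ax ay|x _]; last exact: aP.
  by rewrite leq_pmull.
by rewrite /minn; case: ifP.
Qed.

Lemma contains_walk (D E : digraph) (w : nat -> E) : contains D E ->
  exists w' : nat -> D, forall i j, arc (w i) (w j) -> arc (w' i) (w' j).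
Proof.
case=> S [f [g fK gK] arcf]; exists (fun i => val (g (w i))) => i j wij.
have : arc (g (w i)) (g (w j)) by rewrite -arcf !gK.
by case/sub_arcsP.
Qed.

End Bounds.

Theorem theorem3p3 (R : realType) (k : nat) (hk : (3 <= k)%N) :
  exists eps : R, 0 < eps /\
    forall (n c : int) (C : digraph),
      cycle_orientation k C ->
      #|blocks C| = 2%N ->
      (exists2 B : subdigraph C, B \in blocks C & block_length B = 1%N) ->
      exists D : digraph,
        [/\ n <= #|D|%:Z,
            c <= (chi D)%:Z,
            eps * #|D|%:R <= (min_outdeg D)%:R
          & ~ contains D C].
Proof.
case: k hk => [|[|m]] // hk; have m_gt0 : (0 < m)%N by [].
(* In 8 (m + 1), a factor 4 comes from the separating sets, m + 1 from the number of levels, and 2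
   from a shift graph no larger than the blow-up. *)
exists (8 * m.+1)%:R^-1; split; first by rewrite invr_gt0 ltr0n.
move=> n c C cC card2 len1.
have [N chiN] := chi_glued m `|c|.
(* The first summand makes the blow-up at least as large as the shift graph, the second gives at
   least [n] vertices. *)
pose t := (N.+1 ^ m.+1 + `|n|)%N; exists (glued N t m_gt0).
have le_t : (t <= m.+1 * 2 ^ N.+1 * t)%N.
  by rewrite leq_pmull // muln_gt0 expn_gt0.
split.
- apply: le_trans (lez_abs n) _; rewrite lez_nat card_glued.
  by apply: leq_trans (leq_addl _ _); apply: leq_trans le_t; apply: leq_addl.
- by apply: le_trans (lez_abs c) _; rewrite lez_nat ltnW // chiN.
- rewrite ler_pdivrMl ?ltr0n // -natrM ler_nat; apply: min_outdeg_ge => // x.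
  have := leq_mul (leqnn (2 * m.+1)) (outdeg_glued x).
  have : (N.+1 ^ m.+1 <= t)%N by apply: leq_addr.
  rewrite card_glued; nia.
- move=> DC.
  have [w [walk short]] := two_block_walk (isT : (1 < m.+2)%N) cC card2 len1.
  have [w' w'P] := contains_walk w DC.
  have walk' j : (j <= m)%N -> arc (w' j) (w' j.+1).
    by move=> jm; apply/w'P/walk.
  by have := glued_no_walk walk'; rewrite (w'P _ _ short).
Qed.
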